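(* Let $(\Omega,\Sigma,\mu)$ be a $\sigma$-finite complete measure space, $\phi$ an Orlicz function, and $\tau:\Omega\to\Omega$ a nonsingular measurable transformation such that the composition operator $C_\tau f=f\circ\tau$ is a bounded operator from the Orlicz space $L^\phi(\Omega)$ into itself. For $k\ge 1$ let $\mu_k=\mu\circ\tau^{-k}$, i.e. $\mu_k(A)=\mu((\tau^k)^{-1}(A))$ for $A\in\Sigma$. Then, for an integer $k\ge 1$, the operator $C_\tau$ on $L^\phi(\Omega)$ has ascent $k$ if and only if $k$ is the first positive integer such that the measures $\mu_k$ and $\mu_{k+1}$ are equivalent.
   Context: An Orlicz function is a non-decreasing continuous convex function $\phi:[0,\infty)\to[0,\infty)$ with $\phi(x)=0$ if and only if $x=0$, $\lim_{x\to0}\phi(x)/x=0$ and $\lim_{x\to\infty}\phi(x)/x=\infty$. The Orlicz space $L^\phi(\Omega)$ is the set of ($\mu$-a.e. equivalence classes of) measurable functions $f$ with $\int_\Omega\phi(\alpha|f|)\,d\mu<\infty$ for some $\alpha>0$; it is a Banach space under the Luxemburg norm $\|f\|_\phi=\inf\{k>0:\int_\Omega\phi(|f|/k)\,d\mu\le1\}$. A measurable transformation $\tau:\Omega\to\Omega$ (i.e. $\tau^{-1}(A)\in\Sigma$ for all $A\in\Sigma$) is nonsingular if $\mu(\tau^{-1}(A))=0$ whenever $A\in\Sigma$ and $\mu(A)=0$. $\tau^k$ denotes the $k$-fold composition. Two measures on $\Sigma$ are equivalent if each is absolutely continuous with respect to the other. For an operator $T$ on a vector space with null spaces $N(T^k)$,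 the ascent of $T$ is the smallest natural number $k$ (natural numbers being the positive integers) such that $N(T^k)=N(T^{k+1})$; if no such $k$ exists, the ascent is infinite. *)

(* Defs.v *)
From HB Require Import structures.
From mathcomp Require Import all_boot all_order all_algebra.
From mathcomp Require Import generic_quotient.
From mathcomp Require Import interval_inference ring lra.
From mathcomp Require Import all_classical all_reals all_analysis.
From mathcomp Require Import measurable_realfun.

Set Implicit Arguments.
Unset Strict Implicit.
Unset Printing Implicit Defensive.
Import Order.TTheory GRing.Theory Num.Theory.
Import numFieldNormedType.Exports.

Local Open Scope classical_set_scope.
Local Open Scope ring_scope.
Local Open Scope quotient_scope.

(* Only the restriction of phi to [0, +oo[ is constrained, and only this
   restriction is used below. *)
Record is_orlicz (R : realType) (phi : R -> R) : Prop := IsOrlicz {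
  orlicz_ge0 : forall x : R, 0 <= x -> 0 <= phi x ;
  orlicz_nondecreasing : forall x y : R, 0 <= x -> x <= y -> phi x <= phi y ;
  orlicz_continuous : {within `[0, +oo[, continuous phi} ;
  orlicz_convex : convex_function (`[0, +oo[%classic : set R) phi ;
  orlicz_eq0 : forall x : R, 0 <= x -> phi x = 0 <-> x = 0 ;
  orlicz_lim0 : phi x / x @[x --> 0^'+] --> 0 ;
  orlicz_limy : phi x / x @[x --> +oo] --> +oo }.

Record orliczFunction (R : realType) := OrliczFunction {
  orlicz_fun :> R -> R ;
  orlicz_funP : is_orlicz orlicz_fun }.

Section orlicz_space.
Context (R : realType) (d : measure_display) (T : measurableType d).
Variables (mu : {measure set T -> \bar R}) (phi : orliczFunction R).

Definition orlicz_finite (f : T -> R) : Prop :=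
  exists2 a : R, 0 < a & (\int[mu]_x (phi (a * `|f x|))%:E < +oo)%E.

Definition orlicz_pred : {pred {mfun T >-> R}} :=
  fun f => `[< orlicz_finite f >].

Lemma measurable_orlicz (f : T -> R) (a : R) : 0 <= a ->
  measurable_fun setT f ->
  measurable_fun setT (EFin \o (fun x => phi (a * `|f x|))).
Proof.
move=> a0 mf; apply/measurable_EFinP.
have mphi : measurable_fun (`[0, +oo[%classic : set R) phi.
  apply: subspace_continuous_measurable_fun => //.
  exact: orlicz_continuous (orlicz_funP phi).
apply: (@measurable_comp _ _ _ _ _ _ (`[0, +oo[%classic : set R)) => //.
  by move=> _ [x _ <-] /=; rewrite in_itv/= andbT mulr_ge0.
apply: measurable_funM => //; exact: measurableT_comp.
Qed.

Lemma orlicz_finiteZ (c : R) (f : T -> R) :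
  orlicz_finite f -> orlicz_finite (c *: f).
Proof.
have [nn0 nd _ _ z0 _ _] := orlicz_funP phi.
move=> [a a0 af].
have [->|c0] := eqVneq c 0.
  exists 1 => //; rewrite (_ : (fun x => _) = cst 0%E) ?integral0 ?ltry//.
  by apply/funext => x /=; rewrite scale0r normr0 mulr0; congr EFin; apply/z0.
exists (a / `|c|); first by rewrite divr_gt0// normr_gt0.
rewrite (_ : (fun x => _) = (fun x => (phi (a * `|f x|))%:E))//.
apply/funext => x; congr (phi _)%:E.
by rewrite /= normrM mulrA divfK// normr_eq0.
Qed.

Lemma orlicz_finiteD (f g : T -> R) :
  measurable_fun setT f -> measurable_fun setT g ->
  orlicz_finite f -> orlicz_finite g -> orlicz_finite (f + g).
Proof.
have [nn0 nd _ cvx _ _ _] := orlicz_funP phi.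
move=> mf mg [a a0 af] [b b0 bg].
pose c := Num.min a b.
have c0 : 0 < c by rewrite lt_min a0.
have ca : c <= a by rewrite ge_min lexx.
have cb : c <= b by rewrite ge_min lexx orbT.
have c20 : 0 <= c / 2 by rewrite divr_ge0// ltW.
exists (c / 2); first by rewrite divr_gt0.
have mfg : measurable_fun setT (f + g) by exact: measurable_funD.
apply: (@le_lt_trans _ _
  (\int[mu]_x ((phi (a * `|f x|))%:E + (phi (b * `|g x|))%:E))%E).
  apply: ge0_le_integral => //.
  - by move=> x _; rewrite lee_fin nn0// mulr_ge0.
  - exact: measurable_orlicz.
  - by apply: emeasurable_funD; apply: measurable_orlicz => //; exact: ltW.
  move=> x _; rewrite -EFinD lee_fin.
  apply: (@le_trans _ _
     (phi ((1 / 2) * (c * `|f x|) + (1 - 1 / 2) * (c * `|g x|)))).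
    apply: nd; first by rewrite mulr_ge0.
    rewrite (_ : _ + _ = c / 2 * (`|f x| + `|g x|)); last by field.
    by rewrite ler_wpM2l// ler_normD.
  have t01 : (0 <= 1 / 2 :> R) && (1 / 2 <= 1 :> R) by lra.
  have := cvx (Itv01 (andP t01).1 (andP t01).2) (c * `|f x|) (c * `|g x|).
  rewrite !inE/= !in_itv/= !andbT !mulr_ge0 ?(ltW c0)// => /(_ isT isT).
  rewrite !convRE /= /conv /= => H; apply: (le_trans H).
  have H1 : phi (c * `|f x|) <= phi (a * `|f x|).
    by apply: nd; [rewrite mulr_ge0// ltW|rewrite ler_wpM2r].
  have H2 : phi (c * `|g x|) <= phi (b * `|g x|).
    by apply: nd; [rewrite mulr_ge0// ltW|rewrite ler_wpM2r].
  have H3 : 0 <= phi (a * `|f x|) by rewrite nn0// mulr_ge0// ltW.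
  have H4 : 0 <= phi (b * `|g x|) by rewrite nn0// mulr_ge0// ltW.
  rewrite /= /unstable.onem; lra.
rewrite ge0_integralD//.
- by rewrite lte_add_pinfty.
- by move=> x _; rewrite lee_fin nn0// mulr_ge0// ltW.
- by apply: measurable_orlicz => //; exact: ltW.
- by move=> x _; rewrite lee_fin nn0// mulr_ge0// ltW.
- by apply: measurable_orlicz => //; exact: ltW.
Qed.

Lemma orlicz_submod_closed : submod_closed orlicz_pred.
Proof.
split.
  apply/asboolP; exists 1 => //.
  rewrite (_ : (fun x => _) = cst 0%E) ?integral0 ?ltry//.
  apply/funext => x /=; rewrite normr0 mulr0; congr EFin.
  by apply/(orlicz_eq0 (orlicz_funP phi)).
move=> a f g /asboolP Ff /asboolP Fg; apply/asboolP.
apply: (@orlicz_finiteD (a *: (f : T -> R)) g) => //.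
  exact: measurable_funM.
exact: orlicz_finiteZ.
Qed.

HB.instance Definition _ :=
  GRing.isSubmodClosed.Build R {mfun T >-> R} orlicz_pred orlicz_submod_closed.

Record orliczMfun := OrliczMfun {
  orlicz_mfun :> {mfun T >-> R} ;
  orlicz_mfunP : orlicz_mfun \in orlicz_pred }.

HB.instance Definition _ := [isSub for orlicz_mfun].
HB.instance Definition _ := [Choice of orliczMfun by <:].
HB.instance Definition _ := [SubChoice_isSubLmodule of orliczMfun by <:].

Definition orlicz_ae_eq (f g : orliczMfun) : bool :=
  `[< (f : T -> R) = g %[ae mu] >].

Let orlicz_ae_eq_refl : reflexive orlicz_ae_eq.
Proof. by move=> f; apply/asboolP; exact: ae_eq_refl. Qed.

Let orlicz_ae_eq_sym : symmetric orlicz_ae_eq.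
Proof.
by move=> f g; apply/idP/idP => /asboolP h; apply/asboolP/ae_eq_sym.
Qed.

Let orlicz_ae_eq_trans : transitive orlicz_ae_eq.
Proof.
by move=> f g h /asboolP gf /asboolP fh; apply/asboolP/(ae_eq_trans gf fh).
Qed.

Canonical orlicz_ae_eq_equiv := EquivRel orlicz_ae_eq
  orlicz_ae_eq_refl orlicz_ae_eq_sym orlicz_ae_eq_trans.

Definition orliczSpace : Type := {eq_quot orlicz_ae_eq}.
HB.instance Definition _ := Choice.on orliczSpace.
HB.instance Definition _ := EqQuotient.on orliczSpace.

Definition orlicz_repr (f : orliczSpace) : T -> R := repr f : orliczMfun.

Lemma orlicz_piP (f g : orliczMfun) :
  \pi_orliczSpace f = \pi_orliczSpace g <-> (f : T -> R) = g %[ae mu].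
Proof.
split=> [/eqP|fg]; first by rewrite eqmodE => /asboolP.
by apply/eqP; rewrite eqmodE; apply/asboolP.
Qed.

Lemma orlicz_repr_pi (f : orliczMfun) :
  orlicz_repr (\pi_orliczSpace f) = f %[ae mu].
Proof. by apply/orlicz_piP; rewrite reprK. Qed.

Definition orlicz_add (f g : orliczSpace) : orliczSpace :=
  \pi_orliczSpace (repr f + repr g).
Definition orlicz_opp (f : orliczSpace) : orliczSpace :=
  \pi_orliczSpace (- repr f).
Definition orlicz_scale (a : R) (f : orliczSpace) : orliczSpace :=
  \pi_orliczSpace (a *: repr f).

Lemma orlicz_addE (f g : orliczMfun) :
  orlicz_add (\pi f) (\pi g) = \pi_orliczSpace (f + g).
Proof.
apply/orlicz_piP.
move: (orlicz_repr_pi f) (orlicz_repr_pi g); apply: filterS2 => x /= ef eg _.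
by congr (_ + _); [exact: ef|exact: eg].
Qed.

Lemma orlicz_oppE (f : orliczMfun) :
  orlicz_opp (\pi f) = \pi_orliczSpace (- f).
Proof.
apply/orlicz_piP.
move: (orlicz_repr_pi f); apply: filterS => x /= ef _.
by congr (- _); exact: ef.
Qed.

Lemma orlicz_scaleE (a : R) (f : orliczMfun) :
  orlicz_scale a (\pi f) = \pi_orliczSpace (a *: f).
Proof.
apply/orlicz_piP.
move: (orlicz_repr_pi f); apply: filterS => x /= ef _.
by congr (_ * _); exact: ef.
Qed.

Let orlicz_addA : associative orlicz_add.
Proof.
elim/quotW=> f; elim/quotW=> g; elim/quotW=> h.
by rewrite !orlicz_addE addrA.
Qed.

Let orlicz_addC : commutative orlicz_add.
Proof.
by elim/quotW=> f; elim/quotW=> g; rewrite !orlicz_addE addrC.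
Qed.

Let orlicz_add0 : left_id (\pi_orliczSpace 0) orlicz_add.
Proof. by elim/quotW=> f; rewrite orlicz_addE add0r. Qed.

Let orlicz_addN : left_inverse (\pi_orliczSpace 0) orlicz_opp orlicz_add.
Proof. by elim/quotW=> f; rewrite orlicz_oppE orlicz_addE addNr. Qed.

HB.instance Definition _ := GRing.isZmodule.Build orliczSpace
  orlicz_addA orlicz_addC orlicz_add0 orlicz_addN.

Let orlicz_scaleA a b f :
  orlicz_scale a (orlicz_scale b f) = orlicz_scale (a * b) f.
Proof. by elim/quotW: f => f; rewrite !orlicz_scaleE scalerA. Qed.

Let orlicz_scale1 : left_id 1 orlicz_scale.
Proof. by elim/quotW=> f; rewrite orlicz_scaleE scale1r. Qed.

Let orlicz_scaleDr : right_distributive orlicz_scale +%R.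
Proof.
move=> a; elim/quotW=> f; elim/quotW=> g.
by rewrite /GRing.add/= !(orlicz_scaleE, orlicz_addE) scalerDr.
Qed.

Let orlicz_scaleDl f : {morph orlicz_scale^~ f : a b / a + b >-> a + b}.
Proof.
move=> a b; elim/quotW: f => f.
by rewrite [in RHS]/GRing.add/= !(orlicz_scaleE, orlicz_addE) scalerDl.
Qed.

HB.instance Definition _ := GRing.Zmodule_isLmodule.Build R orliczSpace
  orlicz_scaleA orlicz_scale1 orlicz_scaleDr orlicz_scaleDl.

Lemma orlicz_piD (f g : orliczMfun) :
  \pi_orliczSpace (f + g) = \pi_orliczSpace f + \pi_orliczSpace g.
Proof. by rewrite -orlicz_addE. Qed.

Lemma orlicz_piZ (a : R) (f : orliczMfun) :
  \pi_orliczSpace (a *: f) = a *: \pi_orliczSpace f.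
Proof. by rewrite -orlicz_scaleE. Qed.

(* Independent of the representative, see luxemburg_norm_pi. *)
Definition luxemburg_norm (f : orliczSpace) : R :=
  inf [set k : R | 0 < k /\
    (\int[mu]_x (phi (`|orlicz_repr f x| / k))%:E <= 1)%E].

Lemma luxemburg_norm_pi (f : orliczMfun) :
  luxemburg_norm (\pi f) =
  inf [set k : R | 0 < k /\ (\int[mu]_x (phi (`|f x| / k))%:E <= 1)%E].
Proof.
rewrite /luxemburg_norm; congr inf; apply/seteqP; split => k /= [k0 H];
  split => //; apply: le_trans H; rewrite le_eqVlt; apply/orP; left; apply/eqP;
  have k0' : 0 <= k^-1 by rewrite invr_ge0 ltW.
- under eq_integral do rewrite mulrC.
  under [RHS]eq_integral do rewrite mulrC.
  apply: ae_eq_integral => //; try exact: measurable_orlicz.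
  by move: (orlicz_repr_pi f); apply: filterS => x /= /[apply] ->.
- under eq_integral do rewrite mulrC.
  under [RHS]eq_integral do rewrite mulrC.
  apply: ae_eq_integral => //; try exact: measurable_orlicz.
  by move: (orlicz_repr_pi f); apply: filterS => x /= /[apply] ->.
Qed.

Definition bounded_operator (C : {linear orliczSpace -> orliczSpace}) : Prop :=
  exists M : R, forall f, luxemburg_norm (C f) <= M * luxemburg_norm f.

Definition nonsingular (tau : T -> T) : Prop :=
  forall A, measurable A -> mu A = 0%E -> mu (tau @^-1` A) = 0%E.

Section composition_operator.
Variable tau : T -> T.
Hypothesis mtau : measurable_fun setT tau.
Hypothesis ntau : nonsingular tau.
(* C_tau maps L^phi into itself; ntau makes it well defined on classes. *)
Hypothesis stau : forall f : {mfun T >-> R},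
  orlicz_finite f -> orlicz_finite (f \o tau).

Definition comp_mfun (f : orliczMfun) : {mfun T >-> R} :=
  HB.pack_for {mfun T >-> R} (f \o tau)
    (isMeasurableFun.Build _ _ _ _ (f \o tau)
       (measurableT_comp (measurable_funPT f) mtau)).

Lemma comp_mfunP (f : orliczMfun) : comp_mfun f \in orlicz_pred.
Proof. by apply/asboolP; apply: stau; apply/asboolP; exact: orlicz_mfunP. Qed.

Definition comp_orlicz (f : orliczMfun) : orliczMfun :=
  OrliczMfun (comp_mfunP f).

Definition comp_op_fun (f : orliczSpace) : orliczSpace :=
  \pi_orliczSpace (comp_orlicz (repr f)).

Lemma comp_op_funE (f : orliczMfun) :
  comp_op_fun (\pi f) = \pi_orliczSpace (comp_orlicz f).
Proof.
apply/orlicz_piP.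
have [N [mN N0 fN]] := orlicz_repr_pi f.
exists (tau @^-1` N); split.
- by rewrite -[X in measurable X]setTI; exact: mtau.
- exact: ntau.
- move=> x /= H; apply: fN => /= H'; apply: H => _.
  by have := H' I.
Qed.

Let comp_op_linear : linear comp_op_fun.
Proof.
move=> a; elim/quotW=> f; elim/quotW=> g.
rewrite -orlicz_piZ -orlicz_piD !comp_op_funE -orlicz_piZ -orlicz_piD.
by congr \pi_orliczSpace; apply/val_inj/val_inj.
Qed.

HB.instance Definition _ := GRing.isLinear.Build R orliczSpace orliczSpace _
  comp_op_fun comp_op_linear.

Definition comp_op : {linear orliczSpace -> orliczSpace} := comp_op_fun.

End composition_operator.

End orlicz_space.

Definition smallest_positive (P : nat -> Prop) (k : nat) : Prop :=
  [/\ (0 < k)%N, P k & forall j, (0 < j)%N -> P j -> (k <= j)%N].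

Definition null_space (R : pzRingType) (V : lmodType R) (C : {linear V -> V})
    (k : nat) : set V :=
  [set v | iter k C v = 0].

Definition has_ascent (R : pzRingType) (V : lmodType R) (C : {linear V -> V})
    (k : nat) : Prop :=
  smallest_positive (fun j => null_space C j = null_space C j.+1) k.

Definition equivalent_measures (d : measure_display) (T : measurableType d)
    (R : realType) (m1 m2 : set T -> \bar R) : Prop :=
  m1 `<< m2 /\ m2 `<< m1.

(* Main.v *)
Require Import Defs.
From mathcomp Require Import all_boot all_order all_algebra.
From mathcomp Require Import generic_quotient.
From mathcomp Require Import all_classical all_reals all_analysis.
From mathcomp Require Import measurable_realfun.

Import Order.TTheory GRing.Theory Num.Theory.

(** Write C for the composition operator. Pointwise, C^j f is f \o tau^j, so
    C^j f vanishes almost everywhere exactly when mu_j, the image of mu under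
    tau^j, does not charge the support of f ([null_space_comp_opP]). The null
    space of C^j thus only depends on the mu_j-null sets, and the theorem follows
    from the equivalence, for each single j, of N(C^j) = N(C^(j+1)) with
    mu_j ~ mu_(j+1) ([null_space_stableP]); the two sides of the theorem are then
    the smallest positive j satisfying the same property.

    One half of each condition is automatic: nonsingularity gives
    mu_(j+1) << mu_j as well as N(C^j) `<=` N(C^(j+1)), because the preimage of a
    set by tau^(j+1) is the preimage by tau of its preimage by tau^j. It remains
    to compare mu_j << mu_(j+1) with N(C^(j+1)) `<=` N(C^j).
    - If mu_j << mu_(j+1), apply it to the support of f.
    - Conversely, let mu_(j+1) A = 0 and cut A by sigma-finiteness into countably
      many pieces of finite measure. The indicator of each piece lies in the
      Orlicz space ([indic_orlicz_finite]) and in N(C^(j+1)), hence in N(C^j), so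
      that each piece is mu_j-null, and so is A. *)

Local Open Scope classical_set_scope.
Local Open Scope ring_scope.
Local Open Scope quotient_scope.

Lemma measurable_iter (d : measure_display) (T : measurableType d)
    (tau : T -> T) (mtau : measurable_fun setT tau) (j : nat) :
  measurable_fun setT (iter j tau).
Proof.
elim: j => [|j IHj]; first exact: measurable_id.
exact: measurableT_comp.
Qed.

Lemma measurable_iter_preimage (d : measure_display) (T : measurableType d)
    (tau : T -> T) (mtau : measurable_fun setT tau) (j : nat) (A : set T) :
  measurable A -> measurable (iter j tau @^-1` A).
Proof.
by move=> mA; rewrite -[X in measurable X]setTI; exact: measurable_iter.
Qed.

Lemma pushforward_dominatesP (R : realType) (d : measure_display)
    (T : measurableType d) (d' : measure_display) (T' : measurableType d')
    (mu : {measure set T -> \bar R}) (f g : T -> T') :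
  measurable_fun setT g ->
  pushforward mu f `<< pushforward mu g <->
  (forall A, measurable A -> mu (g @^-1` A) = 0%E -> mu (f @^-1` A) = 0%E).
Proof.
by move=> mg; exact: null_content_dominatesP.
Qed.

Lemma iter_preimageS (T : Type) (tau : T -> T) (j : nat) (A : set T) :
  iter j.+1 tau @^-1` A = tau @^-1` (iter j tau @^-1` A).
Proof. by apply/seteqP; split=> x; rewrite /= -iterS iterSr. Qed.

(** Nonsingularity already provides mu_(j+1) << mu_j, which leaves one of the two
    absolute continuities to be tested. *)
Lemma equivalent_iterP (R : realType) (d : measure_display)
    (T : measurableType d) (mu : {measure set T -> \bar R}) (tau : T -> T)
    (j : nat) :
  measurable_fun setT tau -> nonsingular mu tau ->
  equivalent_measures (pushforward mu (iter j tau))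
                      (pushforward mu (iter j.+1 tau)) <->
  (forall A, measurable A -> mu (iter j.+1 tau @^-1` A) = 0%E ->
     mu (iter j tau @^-1` A) = 0%E).
Proof.
move=> mtau ntau; rewrite /equivalent_measures.
rewrite !pushforward_dominatesP; try exact: measurable_iter.
split=> [[]//|H]; split=> // A mA A0; rewrite iter_preimageS.
by apply: ntau => //; exact: measurable_iter_preimage.
Qed.

Lemma measurable_support (R : realType) (d : measure_display)
    (T : measurableType d) (f : {mfun T >-> R}) : measurable [set x | f x != 0].
Proof.
rewrite (_ : mkset _ = f @^-1` [set~ 0]); last first.
  by apply/seteqP; split=> x /= /eqP.
by rewrite -[X in measurable X]setTI; apply: measurable_funPT => //;
  exact: measurableC.
Qed.

(** Since phi vanishes at 0, the modular of an indicator is phi 1 * mu B; hence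
    the space contains enough functions to detect sets of finite measure. *)
Lemma indic_orlicz_finite (R : realType) (d : measure_display)
    (T : measurableType d) (mu : {measure set T -> \bar R})
    (phi : orliczFunction R) (B : set T) :
  measurable B -> (mu B < +oo)%E -> orlicz_finite mu phi (\1_B : T -> R).
Proof.
move=> mB Boo; exists 1 => //.
have phi0 : phi 0 = 0 by apply/(orlicz_eq0 (orlicz_funP phi)).
have phi1 : 0 <= phi 1 by apply: (orlicz_ge0 (orlicz_funP phi)).
rewrite (_ : (fun x => _) = (fun x => (phi 1)%:E * (\1_B x)%:E)%E); last first.
  apply/funext => x; rewrite -EFinM mul1r indicE.
  by case: (x \in B); rewrite ?normr1 ?normr0 ?mulr1 ?mulr0 ?phi0.
rewrite ge0_integralZl_EFin//; last exact/measurable_EFinP.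
by rewrite integral_indic// setIT lte_mul_pinfty.
Qed.

Section iterated_composition.
Context (R : realType) (d : measure_display) (T : measurableType d)
  (mu : {measure set T -> \bar R}) (phi : orliczFunction R) (tau : T -> T)
  (mtau : measurable_fun setT tau) (ntau : nonsingular mu tau)
  (stau : forall f : {mfun T >-> R},
    orlicz_finite mu phi f -> orlicz_finite mu phi (f \o tau)).

Let C := comp_op mtau ntau stau.

(** The powers of C act on classes of functions; this provides representatives
    for which the formula C^j f = f \o tau^j is an equality of functions. *)
Lemma iter_comp_opE (j : nat) (f : orliczMfun mu phi) :
  exists2 g : orliczMfun mu phi,
    iter j C (\pi_(orliczSpace mu phi) f) = \pi_(orliczSpace mu phi) g &
    (g : T -> R) = f \o iter j tau.
Proof.
elim: j => [|j [g Cg gE]]; first by exists f.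
exists (comp_orlicz mtau stau g).
  by rewrite iterS Cg; exact: comp_op_funE.
by apply/funext => x /=; rewrite gE /= -iterS iterSr.
Qed.

(** This turns kernels of operators into null sets: the preimage by tau^j of the
    support of f is the support of f \o tau^j. *)
Lemma null_space_comp_opP (j : nat) (f : orliczMfun mu phi) :
  null_space C j (\pi_(orliczSpace mu phi) f) <->
  mu (iter j tau @^-1` [set x | f x != 0]) = 0%E.
Proof.
have [g Cg gE] := iter_comp_opE j f.
have pi0 : (0 : orliczSpace mu phi) = \pi_(orliczSpace mu phi) 0 by [].
rewrite /null_space /= Cg pi0 orlicz_piP.
rewrite -negligibleP; last exact/measurable_iter_preimage/measurable_support.
suff -> : iter j tau @^-1` [set x | f x != 0] =
  ~` [set x | setT x -> (g : T -> R) x = 0] by [].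
apply/seteqP; split=> x /=; rewrite gE/=.
  by move=> /eqP + /(_ I).
by move=> H; apply/eqP => fx0; apply: H.
Qed.

(** The theorem for a single exponent. Sigma-finiteness is what allows testing the
    null spaces on indicators of arbitrary measurable sets, since only those of
    finite measure need have their indicator in the Orlicz space. *)
Lemma null_space_stableP (j : nat) : sigma_finite setT mu ->
  null_space C j = null_space C j.+1 <->
  equivalent_measures (pushforward mu (iter j tau))
                      (pushforward mu (iter j.+1 tau)).
Proof.
move=> [F TF mF]; rewrite equivalent_iterP//; split=> [NC A mA A0|H].
  have AE : iter j tau @^-1` A = \bigcup_n iter j tau @^-1` (A `&` F n).
    by rewrite -preimage_bigcup -setI_bigcupr -TF setIT.
  rewrite AE; apply/negligibleP.
    by rewrite -AE; exact: measurable_iter_preimage.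
  apply: negligible_bigcup => n; have [mFn Fnoo] := mF n.
  have mB : measurable (A `&` F n) by exact: measurableI.
  have Boo : (mu (A `&` F n) < +oo)%E.
    by apply: le_lt_trans Fnoo; rewrite le_measure// inE.
  have pB : indic_mfun (A `&` F n) mB \in orlicz_pred mu phi.
    by apply/asboolP; exact: indic_orlicz_finite.
  have BE : [set x | OrliczMfun pB x != 0] = A `&` F n.
    apply/seteqP; split=> x;
      by rewrite /= /mindic indicE pnatr_eq0 eqb0 negbK inE.
  apply/negligibleP; first exact: measurable_iter_preimage.
  rewrite -BE; apply/null_space_comp_opP; rewrite NC; apply/null_space_comp_opP.
  rewrite BE; apply: subset_measure0 A0; [exact: measurable_iter_preimage..|].
  by move=> x [].
apply/seteqP; split; elim/quotW=> f; rewrite !null_space_comp_opP; last first.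
  by apply: H; exact: measurable_support.
move=> f0; rewrite iter_preimageS; apply: ntau => //.
exact/measurable_iter_preimage/measurable_support.
Qed.

End iterated_composition.

Theorem theorem3p1 (R : realType) (d : measure_display) (T : measurableType d)
    (mu : {measure set T -> \bar R}) (phi : orliczFunction R) (tau : T -> T)
    (sfmu : sigma_finite setT mu) (cmu : measure_is_complete mu)
    (mtau : measurable_fun setT tau) (ntau : nonsingular mu tau)
    (stau : forall f : {mfun T >-> R},
      orlicz_finite mu phi f -> orlicz_finite mu phi (f \o tau))
    (btau : bounded_operator (comp_op mtau ntau stau))
    (k : nat) (hk : (0 < k)%N) :
  has_ascent (comp_op mtau ntau stau) k <->
  smallest_positive (fun j =>
    equivalent_measures (pushforward mu (iter j tau))
                        (pushforward mu (iter j.+1 tau))) k.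
Proof.
rewrite /has_ascent; suff -> : (fun j =>
    null_space (comp_op mtau ntau stau) j =
    null_space (comp_op mtau ntau stau) j.+1) =
  (fun j => equivalent_measures (pushforward mu (iter j tau))
                                (pushforward mu (iter j.+1 tau))) by [].
by apply/funext => j; apply/propext; exact: null_space_stableP.
Qed.
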